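(* Let $\Phi:V_1^{\otimes m}\to\mathcal A$ be the linear isomorphism defined on the tensor basis by $\Phi(v_S)=\boldsymbol{x}_S$, $S\subseteq[m]$, where $v_S=w_1\otimes\cdots\otimes w_m$ with $w_i=v_1$ if $i\in S$ and $w_i=v_0$ if $i\notin S$. Then $\Phi$ is an isomorphism of $\mathfrak{sl}_2$-modules.
   Context: Let $m=\binom n2$, where $n$ is the number of vertices, and $[m]=\{1,\dots,m\}$. The graph algebra is $\mathcal A=\mathbb C[x_1,\dots,x_m]/(x_1^2-x_1,\dots,x_m^2-x_m)$, with vector space basis $\boldsymbol{x}_S=\prod_{e\in S}x_e$, $S\subseteq[m]$. Linear operators on $\mathcal A$ are defined by $D_+(\boldsymbol{x}_S)=\sum_{e\in[m]\setminus S}\boldsymbol{x}_{S\cup\{e\}}$, $D_-(\boldsymbol{x}_S)=\sum_{e\in S}\boldsymbol{x}_{S\setminus\{e\}}$, $D_0(\boldsymbol{x}_S)=-(m-2|S|)\boldsymbol{x}_S$ (empty sums are zero). They make $\mathcal A$ an $\mathfrak{sl}_2$-module via $e_\pm\mapsto D_\pm$, $h\mapsto D_0$, where $\mathfrak{sl}_2=\mathfrak{sl}_2(\mathbb C)$ has basis $e_+,e_-,h$ with $[h,e_\pm]=\pm2e_\pm$, $[e_+,e_-]=h$. $V_1$ is the two-dimensional $\mathfrak{sl}_2$-module with basis $v_0,v_1$ and action $e_+v_0=v_1$, $e_+v_1=0$, $e_-v_1=v_0$, $e_-v_0=0$, $hv_0=-v_0$, $hv_1=v_1$. On $V_1^{\otimes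 m}$ the Lie algebra acts diagonally: $X\cdot(w_1\otimes\cdots\otimes w_m)=\sum_i w_1\otimes\cdots\otimes Xw_i\otimes\cdots\otimes w_m$. *)

(* Defs.v *)
From HB Require Import structures.
From mathcomp Require Import all_boot all_order all_algebra.
From mathcomp Require Import boolp reals complex.
From mathcomp Require Import ssrcomplements mpoly.
From mathcomp Require Import ssrAC ring.

Set Implicit Arguments.
Unset Strict Implicit.
Unset Printing Implicit Defensive.

Import GRing.Theory.
Local Open Scope ring_scope.
Local Open Scope quotient_scope.

Section Sl2.
Variable K : fieldType.

(* sl_2 is the space of traceless 2 x 2 matrices, with the commutator. *)
Definition traceless : {pred 'M[K]_2} := [pred M : 'M[K]_2 | \tr M == 0].

Fact traceless_submod_closed : submod_closed traceless.
Proof.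
split=> [|a A B]; first by rewrite inE mxtrace0.
by rewrite !inE mxtraceD mxtraceZ => /eqP-> /eqP->; rewrite mulr0 addr0.
Qed.
HB.instance Definition _ :=
  GRing.isSubmodClosed.Build K 'M[K]_2 traceless traceless_submod_closed.

Record sl2 := Sl2 { sl2_mx :> 'M[K]_2; _ : sl2_mx \in traceless }.
HB.instance Definition _ := [isSub for sl2_mx].
HB.instance Definition _ := [Choice of sl2 by <:].
HB.instance Definition _ := [SubChoice_isSubLmodule of sl2 by <:].

Fact lie_subproof (X Y : sl2) : X *m Y - Y *m X \in traceless.
Proof. by rewrite inE mxtraceD mxtrace_mulC raddfN subrr. Qed.
Definition lie (X Y : sl2) : sl2 := Sl2 (lie_subproof X Y).

Fact e_plus_subproof : delta_mx 0 1 \in traceless.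
Proof. by rewrite inE /mxtrace !big_ord_recl big_ord0 !mxE /= !addr0. Qed.
Definition e_plus : sl2 := Sl2 e_plus_subproof.

Fact e_minus_subproof : delta_mx 1 0 \in traceless.
Proof. by rewrite inE /mxtrace !big_ord_recl big_ord0 !mxE /= !addr0. Qed.
Definition e_minus : sl2 := Sl2 e_minus_subproof.

Fact sl2_h_subproof : delta_mx 0 0 - delta_mx 1 1 \in traceless.
Proof.
by rewrite inE /mxtrace !big_ord_recl big_ord0 !mxE /= subr0 sub0r addr0 subrr.
Qed.
Definition sl2_h : sl2 := Sl2 sl2_h_subproof.

Fact lift0_ord2 : lift ord0 ord0 = 1 :> 'I_2.
Proof. exact/val_inj. Qed.

Fact ord2P (k : 'I_2) : k = 0 \/ k = 1.
Proof. by case: k => [[|[|k]] hk] //; [left | right]; apply/val_inj. Qed.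

Lemma sl2_trE (X : sl2) : X 1 1 = - X 0 0.
Proof.
case: X => X /=; rewrite inE /mxtrace !big_ord_recl big_ord0 addr0 lift0_ord2.
by rewrite addrC addr_eq0 => /eqP.
Qed.

Lemma sl2P (X Y : sl2) :
  X 0 1 = Y 0 1 -> X 1 0 = Y 1 0 -> X 0 0 = Y 0 0 -> X = Y.
Proof.
move=> e01 e10 e00; apply/val_inj/matrixP=> /= i j.
have e11 : X 1 1 = Y 1 1 by rewrite !sl2_trE e00.
by case: (ord2P i) => ->; case: (ord2P j) => ->.
Qed.

Lemma lieE (X Y : sl2) : [/\
    lie X Y 0 1 = 2 * (X 0 0 * Y 0 1 - X 0 1 * Y 0 0),
    lie X Y 1 0 = 2 * (X 1 0 * Y 0 0 - X 0 0 * Y 1 0) &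
    lie X Y 0 0 = X 0 1 * Y 1 0 - X 1 0 * Y 0 1].
Proof.
have mulE (A B : 'M[K]_2) i j : (A *m B) i j = A i 0 * B 0 j + A i 1 * B 1 j.
  by rewrite mxE !big_ord_recl big_ord0 lift0_ord2 addr0.
have E i j : lie X Y i j = (X *m Y) i j - (Y *m X) i j.
  by rewrite [LHS]mxE; congr (_ + _); rewrite mxE.
by split; rewrite E !mulE ?sl2_trE; ring.
Qed.

Fact e_plusE i j : e_plus i j = ((i == 0) && (j == 1))%:R.
Proof. exact: mxE. Qed.
Fact e_minusE i j : e_minus i j = ((i == 1) && (j == 0))%:R.
Proof. exact: mxE. Qed.
Fact sl2_hE i j :
  sl2_h i j = ((i == 0) && (j == 0))%:R - ((i == 1) && (j == 1))%:R.
Proof. by rewrite [LHS]mxE mxE; congr (_ + _); rewrite !mxE. Qed.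
Fact sl2_ZE a (X : sl2) i j : (a *: X) i j = a * X i j.
Proof. exact: mxE. Qed.
Fact sl2_DE (X Y : sl2) i j : (X + Y) i j = X i j + Y i j.
Proof. exact: mxE. Qed.
Let sl2E := (e_plusE, e_minusE, sl2_hE, sl2_ZE, sl2_DE).

Lemma lie_h_e_plus : lie sl2_h e_plus = 2 *: e_plus.
Proof.
have [e01 e10 e00] := lieE sl2_h e_plus.
by apply: sl2P; rewrite ?(e01, e10, e00) !sl2E /=; ring.
Qed.

Lemma lie_h_e_minus : lie sl2_h e_minus = - 2 *: e_minus.
Proof.
have [e01 e10 e00] := lieE sl2_h e_minus.
by apply: sl2P; rewrite ?(e01, e10, e00) !sl2E /=; ring.
Qed.

Lemma lie_e_plus_e_minus : lie e_plus e_minus = sl2_h.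
Proof.
have [e01 e10 e00] := lieE e_plus e_minus.
by apply: sl2P; rewrite ?(e01, e10, e00) !sl2E /=; ring.
Qed.

Lemma sl2_decomp (X : sl2) :
  X = X 0 1 *: e_plus + X 1 0 *: e_minus + X 0 0 *: sl2_h.
Proof. by apply: sl2P; rewrite !sl2E /=; ring. Qed.

Structure sl2Module := Sl2Module {
  sl2_sort :> lmodType K;
  sl2_act : sl2 -> sl2_sort -> sl2_sort;
  sl2_act_linearl : forall v, linear (sl2_act^~ v);
  sl2_act_linearr : forall X, linear (sl2_act X);
  sl2_act_lie : forall X Y v,
    sl2_act (lie X Y) v = sl2_act X (sl2_act Y v) - sl2_act Y (sl2_act X v) }.

Definition sl2_iso (M N : sl2Module) (f : {linear M -> N}) :=
  bijective f /\ forall X v, f (sl2_act X v) = sl2_act X (f v).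

Section OfTriple.
Variables (V : lmodType K) (P M H : {linear V -> V}).
Hypotheses (HP : forall v, H (P v) - P (H v) = 2 *: P v).
Hypotheses (HM : forall v, H (M v) - M (H v) = - 2 *: M v).
Hypotheses (PM : forall v, P (M v) - M (P v) = H v).

(* The entries X 0 1, X 1 0, X 0 0 are the coordinates of X on e_plus, e_minus,
   sl2_h (sl2_decomp), so this is the action with e_plus |-> P, e_minus |-> M,
   sl2_h |-> H. *)
Definition triple_act (X : sl2) (v : V) :=
  X 0 1 *: P v + X 1 0 *: M v + X 0 0 *: H v.

Fact triple_act_linearl v : linear (triple_act^~ v).
Proof.
move=> a X Y; rewrite /triple_act !sl2E !scalerDl -!scalerA !scalerDr.
by rewrite [X in X + _]addrACA [LHS]addrACA.
Qed.

Fact triple_act_linearr X : linear (triple_act X).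
Proof.
move=> a u v; rewrite /triple_act (linearP P) (linearP M) (linearP H) /=.
rewrite !scalerDr !scalerA.
by rewrite !(mulrC _ a) -!scalerA [X in X + _]addrACA [LHS]addrACA.
Qed.

Fact triple_act_lie X Y v :
  triple_act (lie X Y) v =
  triple_act X (triple_act Y v) - triple_act Y (triple_act X v).
Proof.
have lE (f : {linear V -> V}) a b c x y z :
    f (a *: x + b *: y + c *: z) = a *: f x + b *: f y + c *: f z.
  by rewrite !raddfD /= !linearZ.
have subD3 (x y z x' y' z' : V) :
    x + y + z - (x' + y' + z') = (x - x') + (y - y') + (z - z').
  by rewrite !opprD addrACA [X in X + _]addrACA.
rewrite {1}/triple_act; have [-> -> ->] := lieE X Y; rewrite -PM.
have -> c : (2 * c) *: P v = c *: (H (P v) - P (H v)).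
  by rewrite HP scalerA mulrC.
have -> c : (2 * c) *: M v = c *: (M (H v) - H (M v)).
  by rewrite -opprB HM scaleNr opprK scalerA mulrC.
rewrite /triple_act !(lE P) !(lE M) !(lE H) !scalerDr !scalerA.
move: (X 0 1) (X 1 0) (X 0 0) (Y 0 1) (Y 1 0) (Y 0 0) => p q r p' q' r'.
rewrite !subD3 -!scalerBl !scalerN -!scaleNr.
rewrite (mulrC p' p) (mulrC q' q) (mulrC r' r) !subrr !scale0r add0r !addr0.
rewrite [RHS](AC (2*2*2) ((5*2)*(4*6)*(1*3))) /=.
by do ![congr (_ + _)]; congr (_ *: _); ring.
Qed.

Definition sl2_of_triple :=
  Sl2Module triple_act_linearl triple_act_linearr triple_act_lie.

Lemma sl2_of_tripleE v : [/\ @sl2_act sl2_of_triple e_plus v = P v,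
  @sl2_act sl2_of_triple e_minus v = M v & @sl2_act sl2_of_triple sl2_h v = H v].
Proof.
split; rewrite /= /triple_act !sl2E /= ?subr0 !scale0r !scale1r;
  by rewrite ?add0r ?addr0.
Qed.
End OfTriple.
End Sl2.

Section V1.
Variable K : fieldType.

Definition v0 : 'rV[K]_2 := delta_mx 0 0.
Definition v1 : 'rV[K]_2 := delta_mx 0 1.

Definition V1_plus (w : 'rV[K]_2) : 'rV[K]_2 := w 0 0 *: v1.
Definition V1_minus (w : 'rV[K]_2) : 'rV[K]_2 := w 0 1 *: v0.
Definition V1_zero (w : 'rV[K]_2) : 'rV[K]_2 := w 0 1 *: v1 - w 0 0 *: v0.

Fact V1_plus_linear : linear V1_plus.
Proof. by move=> a u v; rewrite /V1_plus !mxE scalerDl scalerA. Qed.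
HB.instance Definition _ :=
  GRing.isLinear.Build K 'rV_2 'rV_2 _ V1_plus V1_plus_linear.

Fact V1_minus_linear : linear V1_minus.
Proof. by move=> a u v; rewrite /V1_minus !mxE scalerDl scalerA. Qed.
HB.instance Definition _ :=
  GRing.isLinear.Build K 'rV_2 'rV_2 _ V1_minus V1_minus_linear.

Fact V1_zero_linear : linear V1_zero.
Proof.
move=> a u v; rewrite /V1_zero !mxE !scalerDl -!scalerA opprD scalerBr.
by rewrite addrACA.
Qed.
HB.instance Definition _ :=
  GRing.isLinear.Build K 'rV_2 'rV_2 _ V1_zero V1_zero_linear.

Fact V1P (u v : 'rV[K]_2) : u 0 0 = v 0 0 -> u 0 1 = v 0 1 -> u = v.
Proof. by move=> e0 e1; apply/rowP => j; case: (ord2P j) => ->. Qed.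

Fact V1_zero_plus w : V1_zero (V1_plus w) - V1_plus (V1_zero w) = 2 *: V1_plus w.
Proof. by apply: V1P; rewrite !mxE /=; ring. Qed.
Fact V1_zero_minus w :
  V1_zero (V1_minus w) - V1_minus (V1_zero w) = - 2 *: V1_minus w.
Proof. by apply: V1P; rewrite !mxE /=; ring. Qed.
Fact V1_plus_minus w :
  V1_plus (V1_minus w) - V1_minus (V1_plus w) = V1_zero w.
Proof. by apply: V1P; rewrite !mxE /=; ring. Qed.

Definition V1 : sl2Module K :=
  sl2_of_triple V1_zero_plus V1_zero_minus V1_plus_minus.

Lemma V1E : [/\ @sl2_act K V1 (e_plus K) v0 = v1, @sl2_act K V1 (e_plus K) v1 = 0,
  @sl2_act K V1 (e_minus K) v1 = v0 & @sl2_act K V1 (e_minus K) v0 = 0].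
Proof.
have E := @sl2_of_tripleE K _ _ _ _ V1_zero_plus V1_zero_minus V1_plus_minus.
have [[p0 m0 _] [p1 m1 _]] := (E v0, E v1).
by split; rewrite ?p0 ?p1 ?m0 ?m1; apply: V1P; rewrite !mxE /=; ring.
Qed.

Lemma V1_hE :
  @sl2_act K V1 (sl2_h K) v0 = - v0 /\ @sl2_act K V1 (sl2_h K) v1 = v1.
Proof.
have E := @sl2_of_tripleE K _ _ _ _ V1_zero_plus V1_zero_minus V1_plus_minus.
have [[_ _ h0] [_ _ h1]] := (E v0, E v1).
by split; rewrite ?h0 ?h1; apply: V1P; rewrite !mxE /=; ring.
Qed.
End V1.

Section TensorPower.
Variables (K : fieldType) (d m : nat).
Local Notation V := 'rV[K]_d.

(* The m-th tensor power of K^d, in coordinates: the entry at s is the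
   coefficient of e_(s 0) (x) ... (x) e_(s (m - 1)).  It has the universal
   property of the tensor power: see tens_multilinear, tensor_lift and
   tensor_ext. *)
Definition tensor_power := {ffun {ffun 'I_m -> 'I_d} -> K^o}.
HB.instance Definition _ := GRing.Lmodule.on tensor_power.

Definition tens (w : {ffun 'I_m -> V}) : tensor_power :=
  [ffun s : {ffun 'I_m -> 'I_d} => \prod_i w i 0 (s i)].

Definition upd (w : {ffun 'I_m -> V}) (i : 'I_m) (u : V) : {ffun 'I_m -> V} :=
  [ffun j => if j == i then u else w j].

Definition multilinear (W : lmodType K) (F : {ffun 'I_m -> V} -> W) :=
  forall w i, linear (fun u => F (upd w i u)).

Fact upd_id w i : upd w i (w i) = w.
Proof. by apply/ffunP=> j; rewrite ffunE; case: eqP => [->|]. Qed.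
Fact upd_eq w i u : upd w i u i = u.
Proof. by rewrite ffunE eqxx. Qed.
Fact upd_neq w i u j : j != i -> upd w i u j = w j.
Proof. by rewrite ffunE => /negPf->. Qed.
Fact upd_upd w i u v : upd (upd w i u) i v = upd w i v.
Proof. by apply/ffunP=> j; rewrite !ffunE; case: eqP. Qed.
Fact upd_comm w i j u v : i != j ->
  upd (upd w i u) j v = upd (upd w j v) i u.
Proof.
move=> ij; apply/ffunP=> k; rewrite !ffunE; case: (eqVneq k j) => // ->.
by rewrite eq_sym (negPf ij).
Qed.

Fact tens_updE w i u (s : {ffun 'I_m -> 'I_d}) :
  tens (upd w i u) s = u 0 (s i) * \prod_(j | j != i) w j 0 (s j).
Proof.
rewrite ffunE (bigD1 i) //= upd_eq; congr (_ * _).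
by apply: eq_bigr => j ji; rewrite upd_neq.
Qed.

Lemma tens_multilinear : multilinear tens.
Proof.
move=> w i a u v; apply/ffunP=> s.
rewrite tens_updE [RHS]ffunE [X in _ = X + _]ffunE !tens_updE !mxE.
by rewrite mulrDl -mulrA.
Qed.

Definition ebasis (s : {ffun 'I_m -> 'I_d}) : {ffun 'I_m -> V} :=
  [ffun i => delta_mx 0 (s i)].

Fact tens_ebasis s t : tens (ebasis s) t = (t == s)%:R.
Proof.
rewrite ffunE; have [->|ne] := eqVneq t s.
  by rewrite big1 // => i _; rewrite ffunE mxE !eqxx.
have [i /negPf ti] : exists i, t i != s i.
  by apply/existsP; apply: contraNT ne; rewrite negb_exists => /forallP h;
     apply/eqP/ffunP => i; apply/eqP; rewrite -[_ == _]negbK.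
by rewrite (bigD1 i) //= ffunE mxE ti mul0r.
Qed.

Fact linear_sumZ (U W : lmodType K) (f : U -> W) (I : finType) (a : I -> K)
    (v : I -> U) :
  linear f -> f (\sum_i a i *: v i) = \sum_i a i *: f (v i).
Proof.
move=> lf; pose f_lin := GRing.isLinear.Build K U W _ f lf.
pose g : {linear U -> W} := HB.pack f f_lin.
by rewrite -[f]/(g : U -> W) linear_sum; apply: eq_bigr => i _; rewrite linearZ.
Qed.

Lemma multilinear_ext (W : lmodType K) (F G : {ffun 'I_m -> V} -> W) :
  multilinear F -> multilinear G -> (forall s, F (ebasis s) = G (ebasis s)) ->
  F =1 G.
Proof.
move=> mF mG FG.
have lin (E : {ffun 'I_m -> V} -> W) w i : multilinear E ->
    E w = \sum_j w i 0 j *: E (upd w i (delta_mx 0 j)).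
  by move=> mE; rewrite -(linear_sumZ _ _ (mE w i)) -row_sum_delta upd_id.
have H k : forall w : {ffun 'I_m -> V},
    (forall i : 'I_m, (k <= i)%N -> exists j, w i = delta_mx 0 j) -> F w = G w.
  elim: k => [|k IHk] w hw.
    pose g i := cid (hw i (leq0n i)).
    suff -> : w = ebasis [ffun i => sval (g i)] by [].
    by apply/ffunP=> i; rewrite !ffunE; apply: (svalP (g i)).
  have [km|km] := ltnP k m; last first.
    by apply: IHk => i ki; have := leq_ltn_trans ki (ltn_ord i); rewrite ltnNge km.
  rewrite (lin F w (Ordinal km)) // (lin G w (Ordinal km)) //.
  apply: eq_bigr => j _; congr (_ *: _); apply: IHk => i.
  have [->|ne] := eqVneq i (Ordinal km); first by exists j; rewrite upd_eq.
  rewrite leq_eqVlt => /orP[/eqP ki|/hw[j' ij']].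
    by case/eqP: ne; apply/val_inj.
  by exists j'; rewrite upd_neq.
by move=> w; apply: (H m) => i; rewrite leqNgt ltn_ord.
Qed.

Lemma tensor_lift (W : lmodType K) (F : {ffun 'I_m -> V} -> W) :
  multilinear F -> {f : {linear tensor_power -> W} | forall w, f (tens w) = F w}.
Proof.
move=> mF; pose f (t : tensor_power) := \sum_s t s *: F (ebasis s).
have lf : linear f.
  move=> a t u; rewrite /f scaler_sumr -big_split; apply: eq_bigr => s _ /=.
  by rewrite !ffunE scalerDl scalerA.
pose f_lin := GRing.isLinear.Build K tensor_power W _ f lf.
pose g : {linear tensor_power -> W} := HB.pack f f_lin.
exists g; apply: multilinear_ext => // [w i a u v|s].
  by rewrite tens_multilinear linearP.
rewrite /= /f (bigD1 s) //= tens_ebasis eqxx scale1r big1 ?addr0 // => t ts.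
by rewrite tens_ebasis (negPf ts) scale0r.
Qed.

Lemma tensor_ext (W : lmodType K) (f g : {linear tensor_power -> W}) :
  (forall s, f (tens (ebasis s)) = g (tens (ebasis s))) -> f =1 g.
Proof.
move=> fg t.
have -> : t = \sum_s t s *: tens (ebasis s).
  apply/ffunP=> s; rewrite sum_ffunE (bigD1 s) //= ffunE tens_ebasis eqxx.
  rewrite [_ *: _]mulr1 big1 ?addr0 // => u us.
  by rewrite ffunE tens_ebasis eq_sym (negPf us) [_ *: _]mulr0.
by rewrite !linear_sum; apply: eq_bigr => s _; rewrite !linearZ /= fg.
Qed.

End TensorPower.

Section TensorModule.
Variables (K : fieldType) (d m : nat).
Local Notation V := 'rV[K]_d.
Variable act : sl2 K -> V -> V.
Hypothesis act_linearl : forall v, linear (act^~ v).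
Hypothesis act_linearr : forall X, linear (act X).
Hypothesis act_lie :
  forall X Y v, act (lie X Y) v = act X (act Y v) - act Y (act X v).

(* w_1 (x) ... (x) w_m |-> \sum_i w_1 (x) ... (x) X w_i (x) ... (x) w_m *)
Definition diag_tens (X : sl2 K) (w : {ffun 'I_m -> V}) : tensor_power K d m :=
  \sum_i tens (upd w i (act X (w i))).

Fact diag_tens_multilinear X : multilinear (diag_tens X).
Proof.
move=> w i a u v; rewrite /diag_tens scaler_sumr -big_split.
apply: eq_bigr => j _ /=; have [->|ji] := eqVneq j i.
  by rewrite !upd_eq !upd_upd act_linearr tens_multilinear.
by rewrite !(upd_neq _ _ ji) !(upd_comm _ _ _ (_ : i != j)) 1?eq_sym // tens_multilinear.
Qed.

Definition diag_act (X : sl2 K) : {linear tensor_power K d m -> tensor_power K d m} :=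
  sval (tensor_lift (diag_tens_multilinear X)).

Lemma diag_actE X w : diag_act X (tens w) = \sum_i tens (upd w i (act X (w i))).
Proof. exact: (svalP (tensor_lift (diag_tens_multilinear X))). Qed.

Fact diag_act_linearl t : linear (diag_act^~ t).
Proof.
move=> a X Y; apply: (tensor_ext (f := diag_act (a *: X + Y))
  (g := (a \*: diag_act X \+ diag_act Y)%R)) => s /=.
rewrite !diag_actE scaler_sumr -big_split; apply: eq_bigr => i _ /=.
by rewrite act_linearl tens_multilinear.
Qed.

Fact diag_act_linearr X : linear (diag_act X).
Proof. exact: linearP. Qed.

Fact diag_act_lie X Y t :
  diag_act (lie X Y) t = diag_act X (diag_act Y t) - diag_act Y (diag_act X t).
Proof.
apply: (tensor_ext (f := diag_act (lie X Y))
  (g := ((diag_act X \o diag_act Y) \- (diag_act Y \o diag_act X))%R)) => s /=.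
move: (ebasis K s) => w.
have compE X' Y' : diag_act X' (diag_act Y' (tens w)) =
    \sum_i tens (upd w i (act X' (act Y' (w i)))) +
    \sum_i \sum_(j | j != i)
      tens (upd (upd w i (act Y' (w i))) j (act X' (w j))).
  rewrite diag_actE linear_sum -big_split; apply: eq_bigr => i _ /=.
  rewrite diag_actE (bigD1 i) //= upd_eq upd_upd; congr (_ + _).
  by apply: eq_bigr => j ji; rewrite upd_neq.
rewrite !compE [X in _ - (_ + X)](exchange_big_dep xpredT) //=.
rewrite [X in _ - (_ + X)](_ : _ = \sum_i \sum_(j | j != i)
      tens (upd (upd w i (act Y (w i))) j (act X (w j)))); last first.
  apply: eq_bigr => i _; apply: eq_big => [j|j ij]; first by rewrite eq_sym.
  by rewrite upd_comm // eq_sym.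
rewrite opprD addrACA subrr addr0 diag_actE -sumrB; apply: eq_bigr => i _.
have := tens_multilinear w i (-1) (act Y (act X (w i))) (act X (act Y (w i))).
by rewrite !scaleN1r addrC => <-; rewrite act_lie addrC.
Qed.

Definition tensor_module_of : sl2Module K :=
  Sl2Module diag_act_linearl diag_act_linearr diag_act_lie.
End TensorModule.

Section V1Tensor.
Variables (K : fieldType) (m : nat).

Definition V1_tensor : sl2Module K :=
  @tensor_module_of K 2 m (@sl2_act K (V1 K))
    (@sl2_act_linearl K (V1 K)) (@sl2_act_linearr K (V1 K))
    (@sl2_act_lie K (V1 K)).

Definition v_ (S : {set 'I_m}) : V1_tensor :=
  tens [ffun i => if i \in S then v1 K else v0 K].

Fact v_ebasis S :
  v_ S = tens (ebasis K [ffun i : 'I_m => if i \in S then 1 : 'I_2 else 0]).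
Proof.
by congr tens; apply/ffunP=> i; rewrite !ffunE; case: (i \in S).
Qed.

Fact ebasis_v (s : {ffun 'I_m -> 'I_2}) :
  tens (ebasis K s) = v_ [set i | s i == 1].
Proof.
rewrite v_ebasis; congr (tens (ebasis K _)); apply/ffunP=> i.
by rewrite ffunE inE; case: (ord2P (s i)) => ->.
Qed.

Lemma V1_tensor_ext (W : lmodType K) (f g : {linear V1_tensor -> W}) :
  (forall S, f (v_ S) = g (v_ S)) -> f =1 g.
Proof. by move=> fg; apply: tensor_ext => s; rewrite ebasis_v; apply: fg. Qed.

Lemma V1_tensor_lift (W : lmodType K) (F : {set 'I_m} -> W) :
  {f : {linear V1_tensor -> W} | forall S, f (v_ S) = F S}.
Proof.
pose G (w : {ffun 'I_m -> 'rV[K]_2}) :=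
  \sum_(s : {ffun 'I_m -> 'I_2}) tens w s *: F [set i | s i == 1].
have mG : multilinear G.
  move=> w i a u v; rewrite /G scaler_sumr -big_split; apply: eq_bigr => s _ /=.
  by rewrite tens_multilinear !ffunE scalerDl scalerA.
have [f fE] := tensor_lift mG; exists f => S.
rewrite v_ebasis fE /G; set s0 := [ffun _ => _].
rewrite (bigD1 s0) //= tens_ebasis eqxx scale1r big1 ?addr0 => [|s ss0].
  by congr F; apply/setP=> i; rewrite inE ffunE; case: (i \in S).
by rewrite tens_ebasis (negPf ss0) scale0r.
Qed.
End V1Tensor.

Section GraphAlgebra.
Variables (K : fieldType) (m : nat).
Local Notation P := {mpoly K[m]}.

(* The ideal generated by the x_i ^ 2 - x_i. *)
Definition graph_ideal : {pred P} := fun p =>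
  `[< exists q : 'I_m -> P, p = \sum_i q i * ('X_i ^+ 2 - 'X_i) >].

Fact graph_ideal_closed : idealr_closed graph_ideal.
Proof.
split.
- apply/asboolP; exists (fun=> 0).
  by rewrite big1 // => i _; rewrite mul0r.
- apply/negP => /asboolP[q /(congr1 (meval (fun=> 0)))].
  rewrite meval1 raddf_sum big1 => [/eqP|i _]; first by rewrite oner_eq0.
  by rewrite /= mevalM mevalB rmorphXn /= mevalXU expr0n subr0 mulr0.
- move=> a u v /asboolP[q ->] /asboolP[r ->]; apply/asboolP.
  exists (fun i => a * q i + r i).
  rewrite mulr_sumr -big_split; apply: eq_bigr => i _ /=.
  by rewrite mulrDl mulrA.
Qed.
HB.instance Definition _ := isIdealr.Build P graph_ideal graph_ideal_closed.

Definition graph_algebra := {ideal_quot graph_ideal}.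
HB.instance Definition _ := GRing.ComNzRing.on graph_algebra.

Definition graph_pi (p : P) : graph_algebra := \pi_{ideal_quot graph_ideal} p.

Fact graph_pi_zmod_morphism : zmod_morphism graph_pi.
Proof. exact: (raddfB (\pi_{ideal_quot graph_ideal})). Qed.
HB.instance Definition _ :=
  GRing.isZmodMorphism.Build P graph_algebra graph_pi graph_pi_zmod_morphism.

Fact graph_pi_monoid_morphism : monoid_morphism graph_pi.
Proof. exact: (pi_is_monoid_morphism {ideal_quot graph_ideal}). Qed.
HB.instance Definition _ :=
  GRing.isMonoidMorphism.Build P graph_algebra graph_pi graph_pi_monoid_morphism.

Definition graph_scale (c : K) (a : graph_algebra) : graph_algebra :=
  graph_pi c%:MP * a.

Fact graph_scaleA a b v :
  graph_scale a (graph_scale b v) = graph_scale (a * b) v.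
Proof. by rewrite /graph_scale mulrA -rmorphM /= mpolyCM. Qed.
Fact graph_scale1 : left_id 1 graph_scale.
Proof. by move=> v; rewrite /graph_scale rmorph1 mul1r. Qed.
Fact graph_scaleDr : right_distributive graph_scale +%R.
Proof. by move=> a u v; rewrite /graph_scale mulrDr. Qed.
Fact graph_scaleDl v : {morph graph_scale^~ v : a b / a + b}.
Proof. by move=> a b; rewrite /graph_scale mpolyCD rmorphD mulrDl. Qed.
HB.instance Definition _ := GRing.Zmodule_isLmodule.Build K graph_algebra
  graph_scaleA graph_scale1 graph_scaleDr graph_scaleDl.

Fact graph_scaleAl a (u v : graph_algebra) : a *: (u * v) = (a *: u) * v.
Proof. exact: mulrA. Qed.
HB.instance Definition _ :=
  GRing.Lmodule_isLalgebra.Build K graph_algebra graph_scaleAl.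
HB.instance Definition _ := GRing.Lalgebra_isComAlgebra.Build K graph_algebra.

Definition gvar (e : 'I_m) : graph_algebra := graph_pi 'X_e.

Definition x_ (S : {set 'I_m}) : graph_algebra := \prod_(e in S) gvar e.

Lemma graph_pi_scalable : scalable graph_pi.
Proof. by move=> c p; rewrite -mul_mpolyC rmorphM. Qed.

Lemma gvar_idem e : gvar e ^+ 2 = gvar e.
Proof.
apply/eqP; rewrite /gvar -rmorphXn -subr_eq0 -rmorphB /=.
rewrite -(rmorph0 graph_pi).
rewrite -Quotient.idealrBE subr0; apply/asboolP; exists (fun i => (i == e)%:R).
rewrite (bigD1 e) //= eqxx mul1r big1 ?addr0 // => i /negPf->.
by rewrite mul0r.
Qed.

Definition msupport (u : 'X_{1..m}) : {set 'I_m} := [set i | u i != 0%N].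

Lemma graph_pi_mon (u : 'X_{1..m}) : graph_pi 'X_[u] = x_ (msupport u).
Proof.
rewrite mpolyXE_id rmorph_prod /x_ [RHS]big_mkcond /=; apply: eq_bigr => e _.
rewrite inE rmorphXn /= -/(gvar e).
case: (u e) => //= k; elim: k => [|k IHk]; first by rewrite expr1.
by rewrite exprS IHk -expr2 gvar_idem.
Qed.

Lemma graph_ext (W : lmodType K) (f g : {linear graph_algebra -> W}) :
  (forall S, f (x_ S) = g (x_ S)) -> f =1 g.
Proof.
move=> fg a; have -> : a = graph_pi (repr a) by rewrite /graph_pi reprK.
rewrite [repr a]mpolyE raddf_sum /= !linear_sum /=; apply: eq_bigr => u _.
by rewrite graph_pi_scalable !linearZ /= graph_pi_mon fg.
Qed.

Lemma graph_lift (W : lmodType K) (F : {set 'I_m} -> W) :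
  {f : {linear graph_algebra -> W} | forall S, f (x_ S) = F S}.
Proof.
pose L (p : P) := \sum_(u <- msupp p) p@_u *: F (msupport u).
have LE k p : (msize p <= k)%N ->
    L p = \sum_(u : 'X_{1..m < k}) p@_u *: F (msupport u).
  move=> pk; pose I : subFinType _ := 'X_{1..m < k}.
  rewrite /L (big_mksub I) ?msupp_uniq //=; first last.
    by move=> x /msize_mdeg_lt/leq_trans/(_ pk) ->.
  by rewrite big_rmcond //= => i /memN_msupp_eq0 ->; rewrite scale0r.
have LX u : L 'X_[u] = F (msupport u).
  by rewrite /L msuppX big_seq1 mcoeffX eqxx scale1r.
have Llin : linear L.
  move=> a p q; pose k := maxn (msize (a *: p + q)) (maxn (msize p) (msize q)).
  rewrite !(LE k) /k ?leq_max ?leqnn ?orbT //.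
  rewrite scaler_sumr -big_split; apply: eq_bigr => u _ /=.
  by rewrite mcoeffD mcoeffZ scalerDl scalerA.
pose Ll := GRing.isLinear.Build K P W _ L Llin.
pose g : {linear P -> W} := HB.pack L Ll.
have LB p q : L (p - q) = L p - L q by exact: (raddfB g p q).
have gI p : p \in graph_ideal -> g p = 0.
  move=> /asboolP[q ->]; rewrite linear_sum big1 // => i _.
  rewrite [q i]mpolyE mulr_suml linear_sum big1 // => u _.
  rewrite -scalerAl linearZ /= mulrBr mpolyXn -!mpolyXD LB !LX.
  rewrite (_ : msupport (u + U_(i) *+ 2)%MM = msupport (u + U_(i))%MM) ?subrr ?scaler0 //.
  apply/setP => j; rewrite !inE !mnmDE mnm1E.
  by rewrite -!lt0n !addn_gt0 orbb.
pose f (a : graph_algebra) := g (repr a).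
have fpi p : f (graph_pi p) = g p.
  apply/eqP; rewrite /f -subr_eq0 -linearB gI //.
  by rewrite Quotient.idealrBE; apply/eqP; rewrite reprK.
have flin : linear f.
  move=> c a b; have -> : a = graph_pi (repr a) by rewrite /graph_pi reprK.
  have -> : b = graph_pi (repr b) by rewrite /graph_pi reprK.
  by rewrite -graph_pi_scalable -raddfD !fpi linearP.
pose fl := GRing.isLinear.Build K graph_algebra W _ f flin.
pose h : {linear graph_algebra -> W} := HB.pack f fl.
exists h => S; pose u : 'X_{1..m} := [multinom (i \in S : nat) | i < m].
have uS : msupport u = S by apply/setP => i; rewrite inE mnmE; case: (i \in S).
by rewrite -uS -graph_pi_mon [LHS]fpi [LHS]LX.
Qed.

Definition D_plus : {linear graph_algebra -> graph_algebra} :=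
  sval (graph_lift (fun S => \sum_(e in ~: S) x_ (e |: S))).
Definition D_minus : {linear graph_algebra -> graph_algebra} :=
  sval (graph_lift (fun S => \sum_(e in S) x_ (S :\ e))).
Definition D_zero : {linear graph_algebra -> graph_algebra} :=
  sval (graph_lift (fun S => - (m%:R - 2 * #|S|%:R) *: x_ S)).

Lemma D_plusE S : D_plus (x_ S) = \sum_(e in ~: S) x_ (e |: S).
Proof. exact: (svalP (graph_lift _)). Qed.
Lemma D_minusE S : D_minus (x_ S) = \sum_(e in S) x_ (S :\ e).
Proof. exact: (svalP (graph_lift _)). Qed.
Lemma D_zeroE S : D_zero (x_ S) = - (m%:R - 2 * #|S|%:R) *: x_ S.
Proof. exact: (svalP (graph_lift _)). Qed.

Lemma D_zero_plus a : D_zero (D_plus a) - D_plus (D_zero a) = 2 *: D_plus a.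
Proof.
apply: (graph_ext (f := ((D_zero \o D_plus) \- (D_plus \o D_zero))%R)
  (g := (2 \*: D_plus)%R)) => S /=.
rewrite D_zeroE linearZ /= D_plusE linear_sum !scaler_sumr -sumrB.
apply: eq_bigr => e; rewrite inE => eS.
by rewrite D_zeroE cardsU1 eS -scalerBl natrD /=; congr (_ *: _); ring.
Qed.

Lemma D_zero_minus a :
  D_zero (D_minus a) - D_minus (D_zero a) = - 2 *: D_minus a.
Proof.
apply: (graph_ext (f := ((D_zero \o D_minus) \- (D_minus \o D_zero))%R)
  (g := (- 2 \*: D_minus)%R)) => S /=.
rewrite D_zeroE linearZ /= D_minusE linear_sum !scaler_sumr -sumrB.
apply: eq_bigr => e eS.
rewrite D_zeroE -scalerBl (cardsD1 e S) eS natrD /=; congr (_ *: _).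
by ring.
Qed.

Lemma D_plus_minus a : D_plus (D_minus a) - D_minus (D_plus a) = D_zero a.
Proof.
apply: (graph_ext (f := ((D_plus \o D_minus) \- (D_minus \o D_plus))%R)
  (g := D_zero)) => S /=.
have -> : D_plus (D_minus (x_ S)) = #|S|%:R *: x_ S +
    \sum_(e in S) \sum_(f in ~: S) x_ (f |: (S :\ e)).
  rewrite D_minusE linear_sum scaler_nat -sumr_const -big_split.
  apply: eq_bigr => e eS; rewrite D_plusE (bigD1 e) ?inE ?eqxx //= setD1K //.
  congr (_ + _); apply: eq_bigl => f; rewrite !inE negb_and negbK.
  by have [->|] := eqVneq f e; rewrite ?eS //= andbT.
have -> : D_minus (D_plus (x_ S)) = (m%:R - #|S|%:R) *: x_ S +
    \sum_(e in S) \sum_(f in ~: S) x_ (f |: (S :\ e)).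
  have -> : m%:R - #|S|%:R = #|~: S|%:R :> K.
    by apply/eqP; rewrite subr_eq addrC -natrD cardsC card_ord.
  rewrite [in RHS]exchange_big /= D_plusE linear_sum scaler_nat -sumr_const.
  rewrite -big_split; apply: eq_bigr => f; rewrite inE => fS.
  rewrite D_minusE (bigD1 f) ?inE ?eqxx //= setU1K //; congr (_ + _).
  apply: eq_big => [e|e]; rewrite !inE.
    by have [->|] := eqVneq e f; rewrite ?(negPf fS) //= andbT.
  move=> /andP[_ ef]; congr x_; apply/setP => k; rewrite !inE.
  by have [->|//] := eqVneq k f; rewrite eq_sym ef.
rewrite opprD addrACA subrr addr0 -scalerBl D_zeroE; congr (_ *: _); ring.
Qed.

Definition graph_module : sl2Module K :=
  sl2_of_triple D_zero_plus D_zero_minus D_plus_minus.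
End GraphAlgebra.

Lemma Phi_exists (K : fieldType) (m : nat) :
  exists Phi : {linear V1_tensor K m -> graph_module K m},
    forall S, Phi (v_ K S) = x_ K S.
Proof.
have [Phi PhiE] :=
  V1_tensor_lift (fun S => x_ K S : graph_module K m); by exists Phi.
Qed.

(* Main.v *)
Require Import Defs.
From HB Require Import structures.
From mathcomp Require Import all_boot all_order all_algebra.
From mathcomp Require Import reals complex.
From mathcomp Require Import ring.

(** Why the theorem holds.  [Phi] carries the basis [v_ S] of the tensor power
    to the family [x_ S], and both families admit linear extension of arbitrary
    functions of [S], uniquely; so the linear map sending [x_ S] back to [v_ S]
    is a two-sided inverse ([basis_map_bijective]).

    For equivariance, the three generators suffice by linearity in the Lie
    algebra ([equivariant_of_generators]), and each is computed on a single
    [v_ S].  The diagonal action changes one tensor factor at a time.  Raising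
    kills the factors v1, those at the positions in [S], and turns a factor v0
    at [e] into v1, that is, [S] into [e |: S]: this is the formula for [D_plus]
    ([e_plus_v_]).  Lowering is symmetric ([e_minus_v_]).  The Cartan element
    acts on each factor by a sign, +1 on [S] and -1 off [S], so it acts on
    [v_ S] by #|S| - #|~: S|, which is the scalar of [D_zero] ([sl2_h_v_]). *)

Import GRing.Theory.
Local Open Scope ring_scope.

(** Both sides are linear in [X], and the three generators span sl_2 as a vector
    space. *)
Lemma equivariant_of_generators (K : fieldType) (M N : sl2Module K)
    (f : {linear M -> N}) :
  (forall v, f (sl2_act (e_plus K) v) = sl2_act (e_plus K) (f v)) ->
  (forall v, f (sl2_act (e_minus K) v) = sl2_act (e_minus K) (f v)) ->
  (forall v, f (sl2_act (sl2_h K) v) = sl2_act (sl2_h K) (f v)) ->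
  forall X v, f (sl2_act X v) = sl2_act X (f v).
Proof.
move=> fP fM fH X v.
have actE (L : sl2Module K) (u : L) :
    sl2_act X u = X 0 1 *: sl2_act (e_plus K) u
      + X 1 0 *: sl2_act (e_minus K) u + X 0 0 *: sl2_act (sl2_h K) u.
  pose a_lin := GRing.isLinear.Build K (sl2 K) L _ (fun Y => sl2_act Y u)
    (sl2_act_linearl u).
  pose a : {linear sl2 K -> L} := HB.pack (fun Y => sl2_act Y u) a_lin.
  rewrite {1}[X]sl2_decomp -[LHS]/(a _).
  by rewrite !linearD !linearZ.
by rewrite !actE !linearD !linearZ /= fP fM fH.
Qed.

Lemma tens_upd0 (K : fieldType) (d m : nat) (w : {ffun 'I_m -> 'rV[K]_d})
    (i : 'I_m) :
  tens (upd w i 0) = 0.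
Proof. by apply/ffunP=> s; rewrite tens_updE ffunE mxE mul0r. Qed.

Lemma tens_updZ (K : fieldType) (d m : nat) (w : {ffun 'I_m -> 'rV[K]_d})
    (i : 'I_m) (a : K) (u : 'rV[K]_d) :
  tens (upd w i (a *: u)) = a *: tens (upd w i u).
Proof. by have := tens_multilinear w i a u 0; rewrite tens_upd0 !addr0. Qed.

Section TensorAction.
Variables (K : fieldType) (m : nat).
Implicit Types (S : {set 'I_m}) (i : 'I_m).

Definition factors S : {ffun 'I_m -> 'rV[K]_2} :=
  [ffun i => if i \in S then v1 K else v0 K].

Lemma V1_tensor_act_v_ (X : sl2 K) S :
  sl2_act X (v_ K S) =
  \sum_i tens (upd (factors S) i (@sl2_act K (V1 K) X (factors S i))).
Proof. exact: diag_actE. Qed.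

(** A factor v1, at [i] in [S], is killed by raising and so kills its summand;
    a factor v0 at [i] becomes v1, which is the factor family of [i |: S]. *)
Lemma e_plus_v_ S :
  sl2_act (e_plus K) (v_ K S) = \sum_(e in ~: S) v_ K (e |: S).
Proof.
have [p0 p1 _ _] := V1E K.
rewrite V1_tensor_act_v_ [RHS]big_mkcond; apply: eq_bigr => i _.
rewrite inE [factors S i]ffunE; case: (boolP (i \in S)) => iS.
  by rewrite p1 tens_upd0.
rewrite p0; congr tens; apply/ffunP => j; rewrite !ffunE !inE.
by case: eqP.
Qed.

Lemma e_minus_v_ S :
  sl2_act (e_minus K) (v_ K S) = \sum_(e in S) v_ K (S :\ e).
Proof.
have [_ _ m1 m0] := V1E K.
rewrite V1_tensor_act_v_ [RHS]big_mkcond; apply: eq_bigr => i _.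
rewrite [factors S i]ffunE; case: (boolP (i \in S)) => iS.
  rewrite m1; congr tens; apply/ffunP => j; rewrite !ffunE !inE.
  by case: eqP.
by rewrite m0 tens_upd0.
Qed.

(** Every factor is an eigenvector, so each summand is [v_ K S] up to sign and
    the eigenvalue is #|S| - #|~: S|; the stated form is that of [D_zero]. *)
Lemma sl2_h_v_ S :
  sl2_act (sl2_h K) (v_ K S) = - (m%:R - 2 * #|S|%:R) *: v_ K S.
Proof.
have [h0 h1] := V1_hE K.
have hw i : @sl2_act K (V1 K) (sl2_h K) (factors S i) =
    (if i \in S then 1 else -1) *: factors S i.
  by rewrite ffunE; case: (i \in S); rewrite ?h0 ?h1 ?scale1r ?scaleN1r.
rewrite V1_tensor_act_v_.
under eq_bigr => i _ do rewrite hw tens_updZ upd_id.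
rewrite -scaler_suml; congr (_ *: _).
have -> : m%:R = #|S|%:R + #|~: S|%:R :> K by rewrite -natrD cardsC card_ord.
rewrite (bigID (mem S)) /=.
rewrite (eq_bigr (fun=> 1)) => [|i /= -> //].
rewrite [X in _ + X](eq_bigr (fun=> -1)) => [|i /negPf-> //].
rewrite sumr_const sumrN (eq_bigl (mem (~: S))) => [|i]; last by rewrite /= inE.
by rewrite sumr_const; ring.
Qed.
End TensorAction.

(** The inverse is the linear extension of the assignment of [v_ K S] to
    [x_ K S]; it exists because the squarefree monomials are independent modulo
    the relations, which is the content of [graph_lift]. *)
Lemma basis_map_bijective (K : fieldType) (m : nat)
    (Phi : {linear V1_tensor K m -> graph_algebra K m}) :
  (forall S, Phi (v_ K S) = x_ K S) -> bijective Phi.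
Proof.
move=> PhiE.
have [Psi PsiE] := graph_lift (fun S => v_ K S : V1_tensor K m).
exists Psi.
  by apply: (V1_tensor_ext (f := (Psi \o Phi)%R) (g := idfun)) => S /=;
     rewrite PhiE PsiE.
by apply: (graph_ext (f := (Phi \o Psi)%R) (g := idfun)) => S /=;
   rewrite PsiE PhiE.
Qed.

(** Two linear maps on the tensor power agree once they agree on every [v_ S],
    where both sides are the explicit formulas for the three operators. *)
Lemma basis_map_equivariant (K : fieldType) (m : nat)
    (Phi : {linear V1_tensor K m -> graph_module K m}) :
  (forall S, Phi (v_ K S) = x_ K S) ->
  forall X v, Phi (sl2_act X v) = sl2_act X (Phi v).
Proof.
move=> PhiE.
have DE := @sl2_of_tripleE K _ _ _ _ (@D_zero_plus K m) (@D_zero_minus K m)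
  (@D_plus_minus K m).
have ext X (D : {linear graph_module K m -> graph_module K m}) :
    (forall a, @sl2_act K (graph_module K m) X a = D a) ->
    (forall S, Phi (sl2_act X (v_ K S)) = D (x_ K S)) ->
    forall v, Phi (sl2_act X v) = sl2_act X (Phi v).
  move=> XD PhiX v; rewrite XD.
  pose a_lin := GRing.isLinear.Build K _ _ _ _
    (@sl2_act_linearr K (V1_tensor K m) X).
  pose a : {linear V1_tensor K m -> V1_tensor K m} := HB.pack (sl2_act X) a_lin.
  apply: (V1_tensor_ext (f := (Phi \o a)%R) (g := (D \o Phi)%R)) => S.
  by rewrite [LHS]PhiX [RHS]/= PhiE.
apply: equivariant_of_generators.
- apply: (ext _ (D_plus K m)) => [a|S]; first by have [] := DE a.
  rewrite e_plus_v_ linear_sum [RHS]D_plusE.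
  by apply: eq_bigr => e _; apply: PhiE.
- apply: (ext _ (D_minus K m)) => [a|S]; first by have [] := DE a.
  rewrite e_minus_v_ linear_sum [RHS]D_minusE.
  by apply: eq_bigr => e _; apply: PhiE.
- apply: (ext _ (D_zero K m)) => [a|S]; first by have [] := DE a.
  by rewrite sl2_h_v_ linearZ /= PhiE [RHS]D_zeroE.
Qed.

Theorem theorem5p1 (R : realType) (n : nat)
    (Phi : {linear V1_tensor R[i] 'C(n, 2) -> graph_module R[i] 'C(n, 2)})
    (PhiE : forall S : {set 'I_('C(n, 2))}, Phi (v_ R[i] S) = x_ R[i] S) :
  sl2_iso Phi.
Proof.
split; first exact: basis_map_bijective PhiE.
exact: basis_map_equivariant PhiE.
Qed.
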